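(* Let $\mathcal{R}\in\mathbb{R}^{d\times d}$ be any skew-symmetric matrix and let $\mathbb{W}=W_K^TW_Q+W_Q^TW_K$. Let $\mathbf{Y}:[t_0,T]\to\mathbb{R}^{2nd}$ be a solution of the system $$\frac{\partial \mathbf{Y}(t)}{\partial t}=\mathcal{B}(\mathbf{Y}(t))\,\mathbf{Y}(t),\qquad \mathcal{B}(\mathbf{Y})=\frac1\epsilon\begin{pmatrix} O & \epsilon I_{\hat n}\\ \mathcal{C}(\mathbf{Y}) & I_{\hat n}\end{pmatrix},\qquad t\in(t_0,T].$$ If $[\mathbb{W},\mathcal{R}]=\mathbb{W}\mathcal{R}-\mathcal{R}\mathbb{W}=O$, then the charge $$Q_\Lambda(t)=-\frac{e^{-t/\epsilon}}{2}\,\mathbf{Y}(t)^T(\mathcal{J}\otimes\mathcal{R})\,\mathbf{Y}(t)$$ is preserved, that is, $Q_\Lambda(t)=Q_\Lambda(t_0)$ for all $t\in(t_0,T]$.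
   Context: Let $n,d,d'$ be positive integers, $\hat n=nd$, $\epsilon>0$, $t_0<T$ real. $\mathcal{V}=\{1,\dots,n\}$ is the node set of an undirected graph without self-loops, with matrix $w=(w_{ij})$, $w_{ij}=1$ if $(i,j)$ is an edge and $w_{ij}=0$ otherwise; thus $w_{ij}=w_{ji}$ and $w_{ii}=0$. $W_K,W_Q\in\mathbb{R}^{d'\times d}$ are fixed matrices, so $\mathbb{W}=W_K^TW_Q+W_Q^TW_K$ is a symmetric $d\times d$ matrix. $g:\mathbb{R}\to\mathbb{R}$ is a differentiable activation function with derivative $g'$. Write $\mathbf{Y}=(\mathbf{x}_1^T,\dots,\mathbf{x}_n^T,\mathbf{P}_1^T,\dots,\mathbf{P}_n^T)^T\in\mathbb{R}^{2\hat n}$ with $\mathbf{x}_i,\mathbf{P}_i\in\mathbb{R}^d$. $\mathcal{C}(\mathbf{Y})$ is the $\hat n\times\hat n$ matrix consisting of $n\times n$ blocks of size $d\times d$ given, for $r,s=1,\dots,n$, by $$\big(\mathcal{C}(\mathbf{Y})\big)_{rr}=-2I_d\sum_{i\in\mathcal{V},\,i\ne r}w_{ri}\,g(\mathbf{x}_r^T\mathbb{W}\mathbf{x}_i),$$ $$\big(\mathcal{C}(\mathbf{Y})\big)_{rs}=w_{rs}\Big(2I_d\,g(\mathbf{x}_r^T\mathbb{W}\mathbf{x}_s)-\mathbb{W}\,g'(\mathbf{x}_r^T\mathbb{W}\mathbf{x}_s)\,\|\mathbf{x}_r-\mathbf{x}_s\|^2\Big)\quad(r\neq s),$$ where $\|\cdot\|$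 is the Euclidean norm. $I_m$ is the identity matrix of order $m$, $O$ is a zero matrix, $\otimes$ is the Kronecker product, and $\mathcal{J}=\begin{pmatrix}O&I_n\\-I_n&O\end{pmatrix}\in\mathbb{R}^{2n\times 2n}$. Equivalently, $Q_\Lambda(t)=e^{-t/\epsilon}\sum_{i\in\mathcal{V}}\mathbf{P}_i(t)^T\mathcal{R}\,\mathbf{x}_i(t)$. *)

(* Defs.v *)
From mathcomp Require Import all_boot all_order all_algebra.
From mathcomp Require Import all_classical all_reals all_analysis.
From mathcomp Require Export mxtens.

Set Implicit Arguments.
Unset Strict Implicit.
Unset Printing Implicit Defensive.

Import Order.TTheory GRing.Theory Num.Theory.
Import numFieldTopology.Exports numFieldNormedType.Exports.

Local Open Scope classical_set_scope.
Local Open Scope ring_scope.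

Section Defs.
Context {R : realType}.

(* At an endpoint of an interval A this is the one-sided derivative. *)
Definition has_derivative_within (m k : nat) (A : set R) (f : R -> 'M[R]_(m, k))
    (t : R) (l : 'M[R]_(m, k)) : Prop :=
  (fun s => (s - t)^-1 *: (f s - f t)) @ within A t^' --> l.

Definition enorm (d : nat) (v : 'cV[R]_d) : R :=
  Num.sqrt (\sum_(k < d) v k 0 ^+ 2).

Definition qform (d : nat) (A : 'M[R]_d) (u v : 'cV[R]_d) : R :=
  (u^T *m A *m v) 0 0.

Definition adjmx (n : nat) (e : rel 'I_n) : 'M[R]_n :=
  \matrix_(i, j) (e i j)%:R.

(* (x_1, ..., x_n) and (P_1, ..., P_n) are the two halves of Y; inside a half,
   coordinate k of block i sits at position i * d + k = mxtens_index (i, k). *)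
Definition xblock (n d : nat) (Y : 'cV[R]_(n * d + n * d)) (i : 'I_n) : 'cV[R]_d :=
  \col_k usubmx Y (mxtens_index (i, k)) 0.

Definition Wsym (d d' : nat) (WK WQ : 'M[R]_(d', d)) : 'M[R]_d :=
  WK^T *m WQ + WQ^T *m WK.

Section System.
Variables (n d : nat) (w : 'M[R]_n) (W : 'M[R]_d) (g : R -> R).

Definition Cblock (Y : 'cV[R]_(n * d + n * d)) (r s : 'I_n) : 'M[R]_d :=
  let x := xblock Y in
  if r == s then
    - (2 * \sum_(i < n | i != r) w r i * g (qform W (x r) (x i)))%:M
  else
    w r s *: ((2 * g (qform W (x r) (x s)))%:M
              - ((g^`())%classic (qform W (x r) (x s)) * enorm (x r - x s) ^+ 2) *: W).

Definition Cmx (Y : 'cV[R]_(n * d + n * d)) : 'M[R]_(n * d) :=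
  \matrix_(p, q)
    Cblock Y (mxtens_unindex p).1 (mxtens_unindex q).1
             (mxtens_unindex p).2 (mxtens_unindex q).2.

Definition Bmx (eps : R) (Y : 'cV[R]_(n * d + n * d)) :
    'M[R]_(n * d + n * d) :=
  eps^-1 *: block_mx 0 eps%:M (Cmx Y) 1%:M.

Definition is_solution (eps t0 T : R) (Y : R -> 'cV[R]_(n * d + n * d)) : Prop :=
  {within `[t0, T], continuous Y} /\
  forall t, t \in `]t0, T] ->
    has_derivative_within `[t0, T] Y t (Bmx eps (Y t) *m Y t).

End System.

Definition Jmx (n : nat) : 'M[R]_(n + n) := block_mx 0 1%:M (- 1%:M) 0.

(* The cast only identifies the index types of size (n + n) * d and
   n * d + n * d; it leaves the positions unchanged. *)
Definition JtensR (n d : nat) (S : 'M[R]_d) : 'M[R]_(n * d + n * d) :=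
  castmx (mulnDl n n d, mulnDl n n d) (Jmx n *t S).

Definition Qcharge (n d : nat) (eps : R) (S : 'M[R]_d)
    (Y : R -> 'cV[R]_(n * d + n * d)) (t : R) : R :=
  - (expR (- t / eps) / 2) * ((Y t)^T *m JtensR n S *m Y t) 0 0.

End Defs.

(* Main.v *)
(* With N = I_n (x) S, where S is the paper's skew matrix R, the matrix J (x) S is
   [[0, N], [-N, 0]] and N is skew.  Since C(Y) is symmetric and commutes with N
   (because W commutes with S), C(Y) N is skew as well.  So in the derivative of
   q = Y^T (J (x) S) Y along the flow the terms x^T C N x and P^T N P vanish, which
   leaves q' = q / eps; the factor exp(-t/eps) compensates exactly this growth. *)
Require Import Defs.
From mathcomp Require Import all_boot all_order all_algebra.
From mathcomp Require Import all_classical all_reals all_analysis.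
From mathcomp Require Import ring.

Import Order.TTheory GRing.Theory Num.Theory.
Import numFieldTopology.Exports numFieldNormedType.Exports.

Local Open Scope classical_set_scope.
Local Open Scope ring_scope.

(** Since [A] is a neighbourhood of [t], restricting the punctured filter at [t] to [A] changes
    nothing, and taking an entry is continuous. This turns the matrix-valued one-sided notion into
    ordinary scalar derivatives. *)
Lemma has_derivative_within_interior {R : realType} {m k : nat} {A : set R}
    {f : R -> 'M[R]_(m, k)} {t : R} {l : 'M[R]_(m, k)} (i : 'I_m) (j : 'I_k) :
  nbhs t A -> has_derivative_within A f t l ->
  is_derive t (1 : R) (fun s => f s i j) (l i j).
Proof.
move=> At ft.
have {}ft : (s - t)^-1 * (f s i j - f t i j) @[s --> t^'] --> l i j.
  have := cvg_comp _ _ ft (@coord_continuous R m k i j l).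
  rewrite /comp => h.
  have wAt : within A t^' = t^'.
    apply/seteqP; split=> P; rewrite /within /dnbhs /within /= => h'.
      by apply: filterS2 At h' => s As h' st; exact: h'.
    by apply: filterS h' => s h' st _; exact: h'.
  rewrite wAt in h.
  apply: cvg_trans h; apply: near_eq_cvg; near=> s.
  by rewrite !mxE.
(* [derive] uses an increment tending to 0, so the quotient is translated by [t]. *)
have lim0 : h^-1 *: (((fun s => f s i j) \o shift t) (h *: 1) - f t i j)
    @[h --> 0^'] --> l i j.
  apply/cvgrPdist_lt => e e0.
  have /cvgrPdist_lt /(_ e e0) := ft.
  rewrite !near_withinE => h.
  move: h; rewrite [X in X -> _](@near_shift R R 0 t) => h.
  apply: filterS h => s /= h s0.
  move: h; rewrite subr0 addrK [s *: 1]mulr1; apply.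
  by rewrite -subr_eq0 addrK.
split; first by apply/cvg_ex; exists (l i j).
exact: cvg_lim.
Unshelve. all: by end_near. Qed.

Lemma is_derive_quadratic_form {R : realType} {N : nat} (M : 'M[R]_N)
    {Y : R -> 'cV[R]_N} {D : 'cV[R]_N} {t : R} :
  (forall i, is_derive t (1 : R) (fun s => Y s i 0) (D i 0)) ->
  is_derive t (1 : R) (fun s => ((Y s)^T *m M *m Y s) 0 0)
    ((D^T *m M *m Y t + (Y t)^T *m M *m D) 0 0).
Proof.
move=> dY.
(* As an explicit sum of products of functions, the form can be differentiated by instance
   inference; what remains is to match the result with the matrix expression. *)
have -> : (fun s => ((Y s)^T *m M *m Y s) 0 0) =
    \sum_(j < N) (\sum_(i < N) (fun s => Y s i 0) * cst (M i j)) *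
      (fun s => Y s j 0).
  apply/funext => s; rewrite mxE fct_sumE; apply: eq_bigr => j _.
  rewrite mxE [RHS]/= fct_sumE; congr (_ * _).
  by apply: eq_bigr => i _; rewrite !mxE.
apply: is_derive_eq.
rewrite !mxE -big_split /=; apply: eq_bigr => j _.
rewrite !mxE addrC fct_sumE; congr (_ + _).
  by congr (_ * _); apply: eq_bigr => i _; rewrite !mxE.
rewrite [LHS]mulrC; congr (_ * _).
by apply: eq_bigr => i _; rewrite !mxE scaler0 add0r [RHS]mulrC.
Qed.

(** Supplies the continuity up to the endpoints that the mean value theorem requires. *)
Lemma within_continuous_quadratic_form (R : realType) (N : nat) (M : 'M[R]_N)
    (A : set R) (Y : R -> 'cV[R]_N) :
  {within A, continuous Y} ->
  {within A, continuous (fun s => ((Y s)^T *m M *m Y s) 0 0)}.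
Proof.
move=> cY t.
have cYi i : (fun s : subspace A => Y s i 0) @ t --> Y t i 0.
  exact: (cvg_comp _ _ (cY t) (@coord_continuous R N 1 i 0 (Y t))).
have -> : (fun s : subspace A => ((Y s)^T *m M *m Y s) 0 0) =
    (fun s => \sum_(j < N) (\sum_(i < N) Y s i 0 * M i j) * Y s j 0).
  apply/funext => s; rewrite mxE; apply: eq_bigr => j _.
  by rewrite mxE; congr (_ * _); apply: eq_bigr => i _; rewrite !mxE.
apply: (cvg_big add_continuous) => j _; apply: cvgM; last exact: cYi.
apply: (cvg_big add_continuous) => i _; apply: cvgM; [exact: cYi | exact: cvg_cst].
Qed.

(** A 1 x 1 matrix is its own transpose, while skewness makes the transpose its negative; so twice
    the entry is 0. *)
Lemma skew_quadratic_form {R : numDomainType} {N : nat} {A : 'M[R]_N} (x : 'cV[R]_N) :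
  A^T = - A -> x^T *m A *m x = 0.
Proof.
move=> skA; apply/matrixP => i j; rewrite !ord1 [RHS]mxE.
have : (x^T *m A *m x)^T = - (x^T *m A *m x).
  by rewrite !trmx_mul trmxK skA mulNmx mulmxN mulmxA.
move=> /matrixP /(_ 0 0); rewrite !mxE => /eqP.
by rewrite -addr_eq0 -mulr2n mulrn_eq0 /= => /eqP.
Qed.

Lemma JtensRE (R : realType) (n d : nat) (S : 'M[R]_d) :
  JtensR n S = block_mx 0 ((1%:M : 'M[R]_n) *t S) (- ((1%:M : 'M[R]_n) *t S)) 0.
Proof.
(* The cast respects blocks: entry [k] of block [i] sits at i * d + k in the first half and at n * d
   + (i * d + k) = (n + i) * d + k in the second. *)
have castl (i : 'I_n) (k : 'I_d) :
    cast_ord (esym (mulnDl n n d)) (lshift _ (mxtens_index (i, k))) =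
    mxtens_index (lshift n i, k) by exact: val_inj.
have castr (i : 'I_n) (k : 'I_d) :
    cast_ord (esym (mulnDl n n d)) (rshift _ (mxtens_index (i, k))) =
    mxtens_index (rshift n i, k).
  by apply: val_inj; rewrite /= mulnDl addnA.
apply/matrixP => p q; rewrite castmxE.
case: (split_ordP p) => p' ->; case: p' / (mxtens_indexP p') => i k;
  case: (split_ordP q) => q' ->; case: q' / (mxtens_indexP q') => j l.
- by rewrite !castl tensmxE !block_mxEul !mxE mul0r.
- by rewrite castl castr tensmxE !block_mxEur tensmxE.
- by rewrite castl castr tensmxE !block_mxEdl !mxE !mxtens_indexK mulNr.
- by rewrite !castr tensmxE !block_mxEdr !mxE mul0r.
Qed.

Section Symmetries.
Variables (R : realType) (n d : nat) (w : 'M[R]_n) (W : 'M[R]_d) (g : R -> R).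
Hypotheses (wT : w^T = w) (WT : W^T = W).

Lemma qformC (u v : 'cV[R]_d) : qform W u v = qform W v u.
Proof.
have -> : qform W u v = (u^T *m W *m v)^T 0 0 by rewrite mxE.
by rewrite !trmx_mul trmxK WT mulmxA.
Qed.

Lemma enormN (v : 'cV[R]_d) : enorm (- v) = enorm v.
Proof. by congr Num.sqrt; apply: eq_bigr => k _; rewrite mxE sqrrN. Qed.

(** Diagonal blocks are scalar. Off the diagonal, [w], the bilinear form of [W] and the distance are
    all symmetric in the two nodes, and [W] is its own transpose. *)
Lemma CblockT Y r s : (Cblock w W g Y r s)^T = Cblock w W g Y s r.
Proof.
rewrite /Cblock eq_sym; case: eqVneq => [->|_].
  by rewrite linearN /= tr_scalar_mx.
rewrite linearZ linearB /= linearZ /= tr_scalar_mx WT qformC -enormN opprB.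
by rewrite -[in LHS]wT mxE.
Qed.

Lemma CmxT Y : (Cmx w W g Y)^T = Cmx w W g Y.
Proof. by apply/matrixP => p q; rewrite !mxE -CblockT mxE. Qed.

(** Every block is a linear combination of the identity and [W]. *)
Lemma Cblock_comm (S : 'M[R]_d) Y r s :
  W *m S = S *m W -> Cblock w W g Y r s *m S = S *m Cblock w W g Y r s.
Proof.
move=> WS; rewrite /Cblock; case: ifP => _.
  by rewrite mulNmx mulmxN scalar_mxC.
rewrite -scalemxAl -scalemxAr mulmxBl mulmxBr scalar_mxC.
by rewrite -scalemxAl -scalemxAr WS.
Qed.

End Symmetries.

Lemma sum_mxtens_index (V : nmodType) (m k : nat) (F : 'I_(m * k) -> V) :
  \sum_p F p = \sum_(i < m) \sum_(l < k) F (mxtens_index (i, l)).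
Proof.
rewrite pair_bigA (reindex (@mxtens_index m k)) /=; last first.
  exists (@mxtens_unindex m k) => p _; [exact: mxtens_indexK|exact: mxtens_unindexK].
by apply: eq_bigr => -[].
Qed.

(** The matrix [1%:M *t S] is block diagonal with all diagonal blocks equal to [S], so block (r, s)
    of the two products is C_rs S and S C_rs, and the claim reduces to [Cblock_comm]. *)
Lemma Cmx_comm (R : realType) (n d : nat) (w : 'M[R]_n) (W S : 'M[R]_d)
    (g : R -> R) Y :
  W *m S = S *m W ->
  Cmx w W g Y *m (1%:M *t S) = (1%:M *t S) *m Cmx w W g Y.
Proof.
move=> WS; apply/matrixP => p q.
case: p / (mxtens_indexP p) => r k; case: q / (mxtens_indexP q) => s l.
have /matrixP /(_ k l) := @Cblock_comm R n d w W g S Y r s WS.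
rewrite !mxE => e.
(* Only the intermediate block [s] contributes on the left, and only [r] on the right. *)
rewrite !sum_mxtens_index (bigD1 s) //= [in RHS](bigD1 r) //=.
rewrite [X in _ + X = _]big1 => [|i ir]; last first.
  by apply: big1 => j _; rewrite tensmxE !mxE (negPf ir) mul0r mulr0.
rewrite [X in _ = _ + X]big1 => [|i ir]; last first.
  by apply: big1 => j _; rewrite tensmxE !mxE eq_sym (negPf ir) !mul0r.
rewrite !addr0; transitivity (\sum_i Cblock w W g Y r s k i * S i l).
  by apply: eq_bigr => i _; rewrite tensmxE !mxE !mxtens_indexK eqxx mul1r.
rewrite e; apply: eq_bigr => i _.
by rewrite tensmxE !mxE !mxtens_indexK eqxx mul1r.
Qed.

Lemma adjmxT {R : realType} {n : nat} {e : rel 'I_n} :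
  symmetric e -> (@adjmx R n e)^T = adjmx e.
Proof. by move=> e_sym; apply/matrixP => i j; rewrite !mxE e_sym. Qed.

Lemma WsymT {R : realType} {d d' : nat} (WK WQ : 'M[R]_(d', d)) :
  (Wsym WK WQ)^T = Wsym WK WQ.
Proof. by rewrite /Wsym linearD /= !trmx_mul !trmxK addrC. Qed.

Lemma JtensR_growth {R : realType} {n d : nat} {eps : R}
    {w : 'M[R]_n} {W S : 'M[R]_d} (g : R -> R) (Y : 'cV[R]_(n * d + n * d)) :
  eps != 0 -> w^T = w -> W^T = W -> S^T = - S -> W *m S = S *m W ->
  let D := Bmx w W g eps Y *m Y in
  D^T *m JtensR n S *m Y + Y^T *m JtensR n S *m D =
  eps^-1 *: (Y^T *m JtensR n S *m Y).
Proof.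
move=> eps0 wT WT ST WS /=; rewrite /Bmx JtensRE.
set N := 1%:M *t S; set C := Cmx w W g Y.
have NT : N^T = - N.
  by rewrite trmx_tens trmx1 ST; apply/matrixP => i j; rewrite !mxE mulrN.
have CT : C^T = C by exact: CmxT.
have CN : C *m N = N *m C by exact: Cmx_comm.
have CNT : (C *m N)^T = - (C *m N) by rewrite trmx_mul NT CT mulNmx CN.
rewrite -(vsubmxK Y); set x := usubmx Y; set P := dsubmx Y.
have PNP := skew_quadratic_form P NT.
have xCNx := skew_quadratic_form x CNT.
(* The vector field becomes [eps^-1] times the column (eps P, C x + P); the factor [eps^-1] is then
   stripped from both sides. *)
rewrite -scalemxAl mul_block_col mul0mx add0r !mul_scalar_mx scale1r.
rewrite linearZ /= !tr_col_mx !linearD /= linearZ /= trmx_mul CT.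
rewrite -?scalemxAl -?scalemxAr -scalerDr; congr (_ *: _).
rewrite !mul_row_block !mulmx0 !add0r !addr0 !mul_row_col.
rewrite !mulmxDl !mulmxDr -!scalemxAl -!scalemxAr !mulmxN !mulNmx PNP.
(* Commutation turns x^T N C x into the vanishing form x^T C N x. *)
have -> : x^T *m N *m (C *m x) = 0.
  by rewrite mulmxA -[x^T *m N *m C]mulmxA -CN.
by rewrite -(mulmxA x^T C) xCNx !(scaler0, oppr0, addr0, add0r).
Qed.

Theorem theorem1 (R : realType) (n d d' : nat) (eps t0 T : R)
    (e : rel 'I_n) (WK WQ : 'M[R]_(d', d)) (g : R -> R) (S : 'M[R]_d)
    (Y : R -> 'cV[R]_(n * d + n * d)) :
  (0 < n)%N -> (0 < d)%N -> (0 < d')%N -> 0 < eps -> t0 < T ->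
  symmetric e -> irreflexive e ->
  (forall u : R, derivable g u 1) ->
  S^T = - S ->
  is_solution (adjmx e) (Wsym WK WQ) g eps t0 T Y ->
  Wsym WK WQ *m S - S *m Wsym WK WQ = 0 ->
  forall t : R, t \in `]t0, T] -> Qcharge eps S Y t = Qcharge eps S Y t0.
Proof.
move=> _ _ _ eps0 t0T e_sym _ _ ST [Yc Yd] /eqP WS t.
rewrite in_itv /= => /andP[t0t tT].
rewrite subr_eq0 in WS; move/eqP: WS => WS.
set q : R -> R := fun s => ((Y s)^T *m JtensR n S *m Y s) 0 0.
set E : R -> R := fun s => - (expR (- s / eps) / 2).
have E' s : is_derive s (1 : R) E (- eps^-1 * E s).
  (* Exhibits [E] as a multiple of a composite, ready for the chain rule. *)
  have -> : E = - (2^-1) \*: (expR \o (- eps^-1 \*: id)).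
    apply/funext => u; rewrite /E /= /GRing.scale /=.
    by rewrite mulrC !mulNr [u / _]mulrC.
  have dlin : is_derive s (1 : R) (- eps^-1 \*: @id R) (- eps^-1 *: 1).
    exact: is_deriveZ.
  have dexp := is_derive1_comp (is_derive_expR _) dlin.
  apply: is_derive_eq (is_deriveZ (- 2^-1) dexp) _.
  rewrite /= /GRing.scale /=; ring.
(* Such an [s] satisfies t0 < s < T even when t = T, so it is interior to the time interval and the
   derivative there is two-sided. *)
have Q' s : s \in `]t0, t[ -> is_derive s (1 : R) (Qcharge eps S Y) 0.
  rewrite in_itv /= => /andP[t0s st].
  have sT := lt_le_trans st tT.
  have nbhs_s : nbhs s `[t0, T]%classic.
    have sin : s \in `]t0, T[ by rewrite in_itv /= t0s.
    apply: filterS (near_in_itvoo sin) => u.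
    exact: subset_itv_oo_cc.
  have dY : has_derivative_within `[t0, T] Y s
      (Bmx (adjmx e) (Wsym WK WQ) g eps (Y s) *m Y s).
    by apply: Yd; rewrite in_itv /= t0s ltW.
  have q' : is_derive s (1 : R) q (eps^-1 * q s).
    have dYi i := has_derivative_within_interior i 0 nbhs_s dY.
    apply: is_derive_eq (is_derive_quadratic_form (JtensR n S) dYi) _.
    have /matrixP /(_ 0 0) -> := JtensR_growth g (Y s)
      (lt0r_neq0 eps0) (adjmxT e_sym) (WsymT WK WQ) ST WS.
    by rewrite mxE.
  (* In the product rule the contributions [eps^-1 * q] and [- eps^-1 * E] cancel. *)
  have -> : Qcharge eps S Y = E * q by [].
  apply: is_derive_eq; rewrite /GRing.scale /=; ring.
have Qc : {within `[t0, t], continuous (Qcharge eps S Y)}.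
  apply: (@continuous_subspaceW _ _ _ `[t0, T]).
    by apply: subset_itvl; rewrite bnd_simp.
  have Ec : {within `[t0, T], continuous E}.
    apply: continuous_subspaceT => u.
    apply: differentiable_continuous; apply/derivable1_diffP.
    exact: (@ex_derive _ _ _ _ _ _ _ (E' u)).
  by move=> s; apply: cvgM; [exact: Ec | exact: within_continuous_quadratic_form].
(* The increment of the charge over [t0, t] equals 0 * (t - t0). *)
have [c _] := MVT t0t Q' Qc.
by rewrite mul0r => /eqP; rewrite subr_eq0 => /eqP.
Qed.
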